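(* Let $n\geq 1$, let $x=(x_1,\dots,x_n)$ be commuting indeterminates, let $a,b$ be complex parameters, and let $\lambda,\mu$ be partitions with $\mu\leq\lambda$. Then $$s_{\lambda/\mu}(a+b,x)=\sum_{\substack{\nu\ \text{partition}\\ \mu\leq\nu\leq\lambda}} s_{\lambda/\nu}(a,x)\,s_{\nu/\mu}(b,x).$$
   Context: A partition $\lambda$ is a finite weakly decreasing sequence $\lambda_1\geq\dots\geq\lambda_r$ of positive integers ($r$ is its number of rows); the empty partition $\emptyset$ ($r=0$) is allowed. For a partition $\mu$ with $r'$ rows and $\lambda$ with $r$ rows, $\mu\leq\lambda$ means $r'\leq r$ and $\mu_i\leq\lambda_i$ for all $i\in\{1,\dots,r\}$, where one sets $\mu_i=0$ for $i>r'$. For an integer $k\geq 0$ define $$S_k(a,x)=\sum_{k_1+\cdots+k_n=k}x_1^{k_1}\cdots x_n^{k_n}\prod_{1\leq m\leq n}\frac{a(a+1)\cdots(a+k_m-1)}{k_m!},$$ where the sum runs over $n$-tuples of nonnegative integers $(k_1,\dots,k_n)$ with sum $k$, and the factor for $k_m=0$ is $1$. In particular $S_0(a,x)=1$; by convention $S_k(a,x)=0$ for $k<0$. For partitions $\mu\leq\lambda$, where $\lambda$ has $r$ rows, define the one parameter extension of the (skew) Schur polynomial by $$s_{\lambda/\mu}(a,x):=\det\big(S_{\lambda_j-\mu_i+i-j}(a,x)\big)_{1\leq i,j\leq r}.$$ For the empty partition, $s_{\emptyset}(a,x)=1$ (an empty determinant equals $1$). *)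

(* Defs.v *)
From HB Require Import structures.
From mathcomp Require Import all_boot all_order all_algebra.
From mathcomp Require Import reals complex mpoly.

Set Implicit Arguments.
Unset Strict Implicit.
Unset Printing Implicit Defensive.

Import GRing.Theory.

Local Open Scope ring_scope.

Definition is_intpart (s : seq nat) : bool := sorted geq s && (0%N \notin s).

Record intpart : Type :=
  IntPart { parts :> seq nat; parts_intpart : is_intpart parts }.

HB.instance Definition _ := [isSub for parts].
HB.instance Definition _ := [Countable of intpart by <:].

(* Rows are numbered from 0, and row i is 0 beyond the last row. *)
Definition row_len (la : intpart) (i : nat) : nat := nth 0%N la i.

Definition le_intpart (mu la : intpart) : bool :=
  (size mu <= size la)%N &&
  [forall i : 'I_(size la), (row_len mu i <= row_len la i)%N].

Declare Scope intpart_scope.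
Delimit Scope intpart_scope with P.
Bind Scope intpart_scope with intpart.
Notation "mu <= la" := (le_intpart mu la) : intpart_scope.

(* All sequences of positive integers (not necessarily decreasing) that have
   at most size s entries and are entrywise bounded by s. *)
Fixpoint subshapes (s : seq nat) : seq (seq nat) :=
  if s is l :: s' then
    [::] :: [seq p :: t | p <- iota 1 l, t <- subshapes s']
  else [:: [::]].

Definition intpart_interval (mu la : intpart) : seq intpart :=
  [seq nu <- pmap insub (subshapes la) | (mu <= nu)%P && (nu <= la)%P].

Lemma subshapes_uniq (s : seq nat) : uniq (subshapes s).
Proof.
elim: s => //= l s IHs; apply/andP; split.
  by apply/negP => /allpairsP[[p t] []].
by apply: allpairs_uniq; rewrite ?iota_uniq //; move=> [p t] [q u] _ _ [-> ->].
Qed.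

Lemma mem_subshapes (s t : seq nat) :
  0%N \notin t -> (size t <= size s)%N ->
  (forall i, (i < size s)%N -> (nth 0%N t i <= nth 0%N s i)%N) ->
  t \in subshapes s.
Proof.
elim: s t => [|l s IHs] [|p t] //=.
rewrite !inE negb_or => /andP[p_gt0 t_gt0] le_ts le_nth /=.
apply/allpairsP; exists (p, t); split=> //=.
  by rewrite mem_iota add1n ltnS lt0n eq_sym p_gt0 /=; apply: (le_nth 0%N).
by apply: IHs => // i lt_is; apply: (le_nth i.+1).
Qed.

Lemma intpart_interval_uniq (mu la : intpart) : uniq (intpart_interval mu la).
Proof. by rewrite filter_uniq // (pmap_sub_uniq _ (subshapes_uniq _)). Qed.

Lemma mem_intpart_interval (mu la nu : intpart) :
  (nu \in intpart_interval mu la) = (mu <= nu)%P && (nu <= la)%P.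
Proof.
rewrite mem_filter; case: (boolP ((mu <= nu)%P && _)) => //=.
case/andP=> _ /andP[le_sz le_nth].
rewrite mem_pmap_sub; case/andP: (parts_intpart nu) => _ nu_gt0.
apply: mem_subshapes => // i lt_i.
exact: (forallP le_nth (Ordinal lt_i)).
Qed.

Definition rising (R : pzRingType) (a : R) (k : nat) : R :=
  \prod_(0 <= i < k) (a + i%:R).

(* The n-tuples (k_1, ..., k_n) with sum k are the monomials of degree k. *)
Definition Spoly_nat (C : fieldType) (n : nat) (a : C) (k : nat) : {mpoly C[n]} :=
  \sum_(m : 'X_{1..n < k.+1} | mdeg m == k)
    (\prod_(i < n) (rising a (m i) / (m i)`!%:R)) *: 'X_[m].

Definition Spoly (C : fieldType) (n : nat) (a : C) (k : int) : {mpoly C[n]} :=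
  if k is Posz k' then Spoly_nat n a k' else 0.

Definition skew_schur (C : fieldType) (n : nat) (la mu : intpart) (a : C) :
    {mpoly C[n]} :=
  \det (\matrix_(i < size la, j < size la)
          Spoly n a ((row_len la j)%:Z - (row_len mu i)%:Z + i%:Z - j%:Z)).

(* Main.v *)
(* Put c = la_1 and r = size la. Since S_k(a, x) is the coefficient of t^k in
   the product of the (1 - x_i t)^(-a), it satisfies S_k(a + b) = sum_j S_j(a)
   S_(k-j)(b), so the matrix defining the left-hand side is a product B A of an
   r x (c + r) matrix and a (c + r) x r matrix. By the Cauchy-Binet formula its
   determinant is a sum over the strictly increasing r-tuples of columns, which
   correspond to integer sequences nu with c >= nu_1 >= nu_2 >= ...; a zero
   block kills the terms in which nu is not between mu and la, and the remaining
   minors are the two skew Schur polynomials. *)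
Require Import Defs.
From mathcomp Require Import all_boot all_order all_fingroup all_algebra.
From mathcomp Require Import reals complex mpoly.
From mathcomp Require Import zify ring.

Set Implicit Arguments.
Unset Strict Implicit.
Unset Printing Implicit Defensive.

Import Order.TTheory GRing.Theory Num.Theory.

Local Open Scope ring_scope.

(** * The Cauchy-Binet formula *)

Definition increasing (r N : nat) (f : 'I_r -> 'I_N) : bool :=
  [forall i : 'I_r, forall j : 'I_r, (i < j)%N ==> (f i < f j)%N].

Lemma increasingP (r N : nat) (f : 'I_r -> 'I_N) :
  reflect (forall i j : 'I_r, (i < j)%N -> (f i < f j)%N) (increasing f).
Proof. by apply: (iffP 'forall_'forall_implyP) => f_lt i j; apply: f_lt. Qed.

Lemma sorted_codom_increasing (r N : nat) (f : 'I_r -> 'I_N) :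
  increasing f -> sorted ltn [seq val k | k <- codom f].
Proof.
move=> /increasingP f_lt; rewrite sorted_map codomE sorted_map.
have : sorted ltn [seq val i | i <- enum 'I_r] by rewrite val_enum_ord iota_ltn_sorted.
by rewrite sorted_map; apply: sub_sorted => i j; apply: f_lt.
Qed.

Lemma increasing_inj (r N : nat) (f : 'I_r -> 'I_N) : increasing f -> injective f.
Proof.
move=> /increasingP f_lt i j eq_f; apply/val_inj; case: (ltngtP i j) => // /f_lt;
by rewrite eq_f ltnn.
Qed.

(** Both increasing maps have the image of the common composite, and an increasing map is determined
    by its image; injectivity then identifies the permutations. *)
Lemma increasing_perm_inj (r N : nat) (g g' : {ffun 'I_r -> 'I_N}) (s s' : 'S_r) :
    increasing g -> increasing g' ->
  [ffun i => g (s i)] = [ffun i => g' (s' i)] -> (g, s) = (g', s').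
Proof.
move=> g_incr g'_incr /ffunP eq_gs.
have eq_gs_at i : g (s i) = g' (s' i) by have := eq_gs i; rewrite !ffunE.
suff eq_g : g = g'.
  rewrite -{}eq_g in eq_gs_at *; congr pair; apply/permP => i.
  exact: increasing_inj g_incr _ _ (eq_gs_at i).
(* Strictly sorted lists with the same elements are equal, so it suffices to compare images. *)
have eq_codom : codom g = codom g'.
  apply: (inj_map val_inj); apply: (irr_sorted_eq ltn_trans ltnn).
  - exact: sorted_codom_increasing.
  - exact: sorted_codom_increasing.
  move=> k; apply/mapP/mapP => -[x /codomP[i ->] ->].
    by exists (g' (s' (s^-1%g i))); rewrite ?codom_f // -eq_gs_at permKV.
  by exists (g (s (s'^-1%g i))); rewrite ?codom_f // eq_gs_at permKV.
rewrite !codomE in eq_codom.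
by apply/ffunP => i; move/eq_in_map: eq_codom; apply; rewrite mem_enum.
Qed.

(** Sorting the values of [f] gives [g], and the sorting permutation is [s]. *)
Lemma injective_increasing_perm (r N : nat) (f : {ffun 'I_r -> 'I_N}) :
  injective f ->
  exists2 g : {ffun 'I_r -> 'I_N}, increasing g &
    exists s : 'S_r, f = [ffun i => g (s i)].
Proof.
move=> f_inj; pose leN := relpre (@nat_of_ord N) leq.
have leN_total : total leN by move=> x y; apply: leq_total.
have sz : size (sort leN (codom f)) == r by rewrite size_sort size_codom card_ord.
pose t := Tuple sz.
have [s eq_s] : exists s : 'S_r, codom f = [tuple tnth t (s i) | i < r].
  by apply/tuple_permP; rewrite perm_sym perm_sort.
exists [ffun i => tnth t i]; last first.
  exists s; apply/ffunP => i; rewrite !ffunE.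
  have : nth (f i) (codom f) i = nth (f i) [tuple tnth t (s i) | i < r] i.
    by rewrite eq_s.
  by rewrite -tnth_nth tnth_mktuple codomE (nth_map i) ?size_enum_ord // nth_ord_enum.
apply/increasingP => i j lt_ij; rewrite !ffunE.
have : sorted ltn [seq val k | k <- t].
  rewrite ltn_sorted_uniq_leq map_inj_uniq ?sort_uniq; last exact: val_inj.
  have uniq_f : uniq (codom f) by apply/injectiveP.
  by rewrite uniq_f sorted_map sort_sorted.
move=> /(sorted_ltn_nth ltn_trans 0%N) /(_ i j).
rewrite !inE size_map size_tuple => /(_ (ltn_ord i) (ltn_ord j) lt_ij).
by rewrite !(nth_map (tnth t i)) ?size_tuple // -!tnth_nth.
Qed.

(** Multilinearity in the rows of the product expands the determinant over all maps [f]. A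
    non-injective [f] repeats a row of [A] and contributes 0. An injective one factors uniquely as
    an increasing [g] after a permutation [s]; the sign from reordering the rows of [A] turns the
    sum over [s] into the minor of [B]. *)
Lemma cauchy_binet (R : comPzRingType) (r N : nat)
    (B : 'M[R]_(r, N)) (A : 'M[R]_(N, r)) :
  \det (B *m A) =
  \sum_(f : {ffun 'I_r -> 'I_N} | increasing f)
    \det (colsub f B) * \det (rowsub f A).
Proof.
pose P (f : {ffun 'I_r -> 'I_N}) := \prod_i B i (f i) * \det (rowsub f A).
have -> : \det (B *m A) = \sum_f P f.
  under [RHS]eq_bigr do rewrite /P big_distrr /=.
  rewrite exchange_big; apply: eq_bigr => /= s _.
  under eq_bigr do rewrite mxE.
  rewrite bigA_distr_bigA big_distrr /=; apply: eq_bigr => f _.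
  rewrite big_split /= mulrCA; congr (_ * (_ * _)).
  by apply: eq_bigr => i _; rewrite mxE.
pose h (p : {ffun 'I_r -> 'I_N} * 'S_r) := [ffun i => p.1 (p.2 i)].
pose D := [pred p : {ffun 'I_r -> 'I_N} * 'S_r | increasing p.1].
transitivity (\sum_(f in [set h p | p in D]) P f).
  rewrite [LHS](bigID (mem [set h p | p in D])) /= [X in _ + X]big1 ?addr0 // => f.
  apply: contraNeq => Pf_neq0; have f_inj : injective f.
    move=> i j eq_f; apply/eqP; apply: contraNT Pf_neq0 => neq_ij.
    by rewrite /P (determinant_alternate neq_ij) ?mulr0 // => k; rewrite !mxE eq_f.
  have [g g_incr [s eq_f]] := injective_increasing_perm f_inj.
  by apply/imsetP; exists (g, s).
rewrite big_imset /=; last first.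
  by move=> [g s] [g' s']; rewrite !inE /=; apply: increasing_perm_inj.
transitivity (\sum_(g : {ffun 'I_r -> 'I_N} | increasing g)
    \sum_(s : 'S_r) P (h (g, s))).
  by rewrite pair_big_dep; apply: eq_big => [[g s]|[g s] _] //=; rewrite inE andbT.
apply: eq_bigr => g _; rewrite [\det (colsub g B)]/determinant big_distrl /=.
apply: eq_bigr => s _; rewrite /P.
have -> : rowsub (h (g, s)) A = row_perm s (rowsub g A).
  by apply/matrixP => i j; rewrite !mxE ffunE.
rewrite row_permE det_mulmx det_perm mulrCA mulrA.
by congr (_ * _ * _); apply: eq_bigr => i _; rewrite mxE ffunE.
Qed.

(** * Addition formula in the parameter for the polynomials [S_k] *)

(** Chu-Vandermonde for rising factorials, by induction on [k]: the new factor splits as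
    [a + b + k = (a + j) + (b + k - j)], each summand extends one of the two rising factorials, and
    Pascal's rule recombines the binomials. *)
Lemma rising_add (R : comPzRingType) (a b : R) (k : nat) :
  rising (a + b) k = \sum_(j < k.+1) (rising a j * rising b (k - j)) *+ 'C(k, j).
Proof.
have risingS (c : R) j : rising c j.+1 = rising c j * (c + j%:R).
  by rewrite /rising big_nat_recr.
elim: k => [|k IHk]; first by rewrite big_ord1 /rising !big_geq // mulr1.
pose T j := (rising a j * rising b (k - j)) *+ 'C(k, j).
rewrite risingS {}IHk big_distrl /=.
under eq_bigr => j _.
  have -> : T j * (a + b + k%:R) = (rising a j.+1 * rising b (k - j)) *+ 'C(k, j)
      + (rising a j * rising b (k.+1 - j)) *+ 'C(k, j).
    have le_jk : (j <= k)%N by rewrite -ltnS.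
    rewrite subSn // !risingS /T mulrnAl -mulrnDl; congr (_ *+ _).
    by rewrite natrB //; ring.
  over.
rewrite big_split /= addrC [RHS]big_ord_recl [X in X + _ = _]big_ord_recl /=.
under [X in _ = _ + X]eq_bigr do rewrite binS mulrnDr subSS /bump /= add1n.
rewrite big_split /= addrA !bin0; congr (_ + _).
rewrite big_ord_recr /= bin_small // mulr0n addr0; congr (_ + _).
Qed.

(** The coefficient of [t^k] in [(1 - t)^(-a)]. *)
Definition rising_ratio (C : fieldType) (a : C) (k : nat) : C := rising a k / k`!%:R.

Lemma rising_ratio_add (C : numFieldType) (a b : C) (k : nat) :
  rising_ratio (a + b) k = \sum_(j < k.+1) rising_ratio a j * rising_ratio b (k - j).
Proof.
rewrite /rising_ratio rising_add big_distrl /=; apply: eq_bigr => j _.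
have le_jk : (j <= k)%N by rewrite -ltnS.
have fact_neq0 m : m`!%:R != 0 :> C by rewrite pnatr_eq0 -lt0n fact_gt0.
rewrite -(bin_fact le_jk) !natrM -mulr_natr; field.
by rewrite !fact_neq0 pnatr_eq0 -lt0n bin_gt0.
Qed.

Lemma mcoeff_Spoly_nat (C : fieldType) (n : nat) (a : C) (k : nat) (m : 'X_{1..n}) :
  (Spoly_nat n a k)@_m = if mdeg m == k then \prod_(i < n) rising_ratio a (m i) else 0.
Proof.
rewrite /Spoly_nat raddf_sum /=.
under eq_bigr do rewrite mcoeffZ mcoeffX.
case: eqP => [deg_m|deg_m]; last first.
  rewrite big1 // => m' /eqP deg_m'.
  by case: eqP deg_m' deg_m => [->//|_]; rewrite mulr0.
have lt_m : (mdeg m < k.+1)%N by rewrite deg_m.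
rewrite (bigD1 (BMultinom lt_m)) /= ?deg_m // eqxx mulr1 [X in _ + X]big1 ?addr0 //.
move=> m' /andP[_]; rewrite -val_eqE /= => /negPf ->.
by rewrite mulr0.
Qed.

Lemma Spoly_nat0 (C : fieldType) (n : nat) (a : C) : Spoly_nat n a 0 = 1.
Proof.
apply/mpolyP => m; rewrite mcoeff_Spoly_nat mcoeff1 mdeg_eq0.
case: eqP => [->|//]; rewrite big1 // => i _.
by rewrite mnm0E /rising_ratio /rising big_geq // divr1.
Qed.

Lemma mcoeff_mul (R : nzRingType) (n : nat) (p q : {mpoly R[n]}) (m : 'X_{1..n}) :
  (p * q)@_m = \sum_(u : 'X_{1..n < (mdeg m).+1} | (u <= m)%MM) p@_u * q@_(m - u).
Proof. exact/mcoeff_poly_mul_lin/ltnSn. Qed.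

(** Compare coefficients at a monomial [m]: the right-hand side becomes a sum over the divisors [u]
    of [m], which factors over the variables into instances of [rising_ratio_add]. *)
Lemma Spoly_nat_add (C : numFieldType) (n : nat) (a b : C) (k : nat) :
  Spoly_nat n (a + b) k = \sum_(j < k.+1) Spoly_nat n a j * Spoly_nat n b (k - j).
Proof.
apply/mpolyP => m; rewrite mcoeff_Spoly_nat raddf_sum /=.
under [RHS]eq_bigr do rewrite mcoeff_mul.
rewrite exchange_big /=.
(* For a fixed divisor [u], homogeneity leaves only the index [j = mdeg u]. *)
have in_degree (u : 'X_{1..n < (mdeg m).+1}) : (u <= m)%MM ->
  \sum_(j < k.+1) (Spoly_nat n a j)@_u * (Spoly_nat n b (k - j))@_(m - u) =
  if mdeg m == k then
    \prod_(i < n) (rising_ratio a (u i) * rising_ratio b (m i - u i))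
  else 0.
  move=> le_um; have deg_m : mdeg m = (mdeg (m - u)%MM + mdeg u)%N.
    by rewrite -mdegD submK.
  under eq_bigr do rewrite !mcoeff_Spoly_nat.
  case: eqP => [deg_mk|deg_mk]; last first.
    apply: big1 => j _; case: eqP => [deg_u|]; last by rewrite mul0r.
    case: eqP => [deg_mu|]; last by rewrite mulr0.
    by move: (ltn_ord j); lia.
  have lt_u : (mdeg u < k.+1)%N by lia.
  rewrite (bigD1 (Ordinal lt_u)) //= eqxx [X in _ + X]big1 ?addr0.
    rewrite ifT; last by lia.
    by rewrite -big_split; apply: eq_bigr => i _; rewrite mnmBE.
  by move=> j; rewrite -val_eqE /= eq_sym => /negPf ->; rewrite mul0r.
rewrite (eq_bigr _ in_degree) {in_degree}.
case: (mdeg m == k); last by rewrite big1.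
have le_deg i (u : 'X_{1..n}) : (u i <= mdeg u)%N.
  by rewrite mdegE (bigD1 i) //= leq_addr.
(* Divisors of [m] are recoded as functions into the finite type ['I_K], where a product of sums
   distributes; [K] exceeds every exponent that occurs. *)
pose K := (mdeg m).+1; pose Q i := [pred j : 'I_K | (j <= m i)%N].
pose h (u : 'X_{1..n < K}) : {ffun 'I_n -> 'I_K} := [ffun i => inord (u i)].
have hE u i : h u i = u i :> nat.
  by rewrite ffunE inordK //; apply: leq_ltn_trans (le_deg i u) (bmdeg u).
transitivity (\sum_(f in family Q)
    \prod_i (rising_ratio a (f i) * rising_ratio b (m i - f i))).
  rewrite -(bigA_distr_big_dep _
    (fun i (j : 'I_K) => rising_ratio a j * rising_ratio b (m i - j))).
  apply: eq_bigr => i _; rewrite rising_ratio_add.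
  rewrite (big_ord_widen K (fun j => rising_ratio a j * rising_ratio b (m i - j))) //.
  exact: le_deg.
pose D := [pred u : 'X_{1..n < K} | (u <= m)%MM].
rewrite (eq_bigl (mem [set h u | u : 'X_{1..n < K} in D])) /=.
  rewrite big_imset /=.
    by apply: eq_bigr => u _; apply: eq_bigr => i _; rewrite hE.
  move=> u v _ _ eq_h; apply/val_inj/mnmP => i /=.
  by rewrite -!hE eq_h.
move=> f; apply/familyP/imsetP => [f_le|[u u_le ->] i]; last first.
  by rewrite inE hE; apply: (mnm_lepP u_le).
pose v := [multinom (f i : nat) | i < n].
have le_vm : (v <= m)%MM by apply/mnm_lepP => i; rewrite mnmE; apply: f_le.
have lt_v : (mdeg v < K)%N by rewrite ltnS -(submK le_vm) mdegD leq_addl.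
exists (BMultinom lt_v) => //.
by apply/ffunP => i; apply/val_inj; rewrite /= hE mnmE.
Qed.

Lemma Spoly_lt0 (C : fieldType) (n : nat) (a : C) (k : int) : k < 0 -> Spoly n a k = 0.
Proof. by case: k. Qed.

(** The intermediate integer [c - k] runs down from [c]. Terms with [c - k] outside the interval
    from [q] to [p] vanish, and the two hypotheses put that interval inside the range of
    summation. *)
Lemma Spoly_add (C : numFieldType) (n : nat) (a b : C) (c p q : int) (N : nat) :
    p <= c -> c - q < N%:Z ->
  Spoly n (a + b) (p - q) =
  \sum_(k < N) Spoly n b (c - k%:Z - q) * Spoly n a (p - (c - k%:Z)).
Proof.
move=> le_pc lt_N.
have [lt_pq|le_qp] := ltP p q.
  rewrite Spoly_lt0 ?big1 //; last by lia.
  move=> k _; have [lt_kq|le_kq] := ltP (c - k%:Z - q) 0.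
    by rewrite [X in X * _]Spoly_lt0 ?mul0r.
  by rewrite [X in _ * X]Spoly_lt0 ?mulr0 //; lia.
(* The terms that can be nonzero are those with [e <= k <= e + d]; shifting by [e] gives the
   convolution for [S_d]. *)
have [d eq_d] : exists d : nat, p - q = d by exists `|p - q|%N; lia.
have [e eq_e] : exists e : nat, c - p = e by exists `|c - p|%N; lia.
have le_N : (e + d.+1 <= N)%N by lia.
pose F (k : nat) := Spoly n b (c - k%:Z - q) * Spoly n a (p - (c - k%:Z)).
have F_lt k : (k < e)%N -> F k = 0.
  by move=> lt_ke; rewrite /F [X in _ * X]Spoly_lt0 ?mulr0 //; lia.
have F_gt k : (e + d < k)%N -> F k = 0.
  by move=> lt_k; rewrite /F [X in X * _]Spoly_lt0 ?mul0r //; lia.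
rewrite -(big_mkord xpredT F) (@big_cat_nat _ _ _ e) //=; last by lia.
rewrite (@big_cat_nat _ _ _ (e + d.+1) e) //=; [|lia..].
rewrite [\sum_(0 <= k < e) _]big1_seq ?add0r; last first.
  by move=> k; rewrite mem_index_iota => /andP[_ lt_ke]; apply: F_lt.
rewrite [\sum_(e + d.+1 <= k < N) _]big1_seq ?addr0; last first.
  by move=> k; rewrite mem_index_iota addnS => /andP[_ /andP[lt_k _]]; apply: F_gt.
rewrite -{1}[e]add0n big_addn addKn big_mkord eq_d /= Spoly_nat_add.
apply: eq_bigr => k _; rewrite mulrC /F.
have -> : c - (k + e)%N%:Z - q = (d - k)%N by move: (ltn_ord k); lia.
by have -> : p - (c - (k + e)%N%:Z) = k by lia.
Qed.

(** * Determinants with a zero block *)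

(* Each permutation meets the block: it cannot map the [k.+1] first rows into
   the [k] first columns. *)
Lemma det_zero_block (R : comPzRingType) (r : nat) (A : 'M[R]_r) (k : 'I_r) :
  (forall i j : 'I_r, (i <= k <= j)%N -> A i j = 0) -> \det A = 0.
Proof.
move=> A0; apply: big1 => s _.
have [i le_ik le_ks] : exists2 i : 'I_r, (i <= k)%N & (k <= s i)%N.
  apply/exists_inP; apply: contraT; rewrite negb_exists_in => /forall_inP s_lt.
  have card_lt m : (m <= r)%N -> #|[set i : 'I_r | (i < m)%N]| = m.
    move=> le_mr; rewrite -sum1dep_card -[RHS]card_ord -sum1_card.
    by rewrite (big_ord_widen r (fun=> 1%N)).
  have : s @: [set i : 'I_r | (i < k.+1)%N] \subset [set i : 'I_r | (i < k)%N].
    by apply/subsetP => _ /imsetP[i + ->]; rewrite !inE ltnS ltnNge => /s_lt.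
  move=> /subset_leq_card; rewrite card_imset; last exact: perm_inj.
  by rewrite !card_lt ?ltnn // ltnW.
by rewrite (bigD1 i) //= A0 ?le_ik // mul0r mulr0.
Qed.

(** * Partitions described by their row lengths *)

Lemma row_len_default (la : intpart) (i : nat) : (size la <= i)%N -> row_len la i = 0%N.
Proof. exact: nth_default. Qed.

Lemma row_len_gt0 (la : intpart) (i : nat) : (0 < row_len la i)%N = (i < size la)%N.
Proof.
case: (ltnP i (size la)) => [lt_i|le_i]; last by rewrite row_len_default.
rewrite lt0n; case/andP: (parts_intpart la) => _; apply: contraNneq => eq0.
by rewrite -eq0 mem_nth.
Qed.

Lemma row_len_anti (la : intpart) (i j : nat) :
  (i <= j)%N -> (row_len la j <= row_len la i)%N.
Proof.
move=> le_ij; case: (ltnP j (size la)) => [lt_j|le_j]; last first.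
  by rewrite row_len_default.
case/andP: (parts_intpart la) => la_sorted _.
apply: (sorted_leq_nth (leT := geq)) => //; last by rewrite inE (leq_ltn_trans le_ij).
  by move=> x y z le_xy /leq_trans; apply.
exact: leqnn.
Qed.

Lemma row_len_inj (la mu : intpart) : row_len la =1 row_len mu -> la = mu.
Proof.
move=> eq_row; apply/val_inj/(@eq_from_nth _ 0%N) => [|i _]; last exact: eq_row.
apply/eqP; rewrite eqn_leq !(leqNgt (size _)) -!row_len_gt0.
rewrite eq_row -[in X in _ && X]eq_row !row_len_gt0.
by rewrite !ltnn.
Qed.

(** The comparison of sizes follows from that of rows, because the parts of a partition are exactly
    its positive rows. *)
Lemma le_intpartP (mu la : intpart) :
  reflect (forall i, (row_len mu i <= row_len la i)%N) (mu <= la)%P.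
Proof.
apply: (iffP andP) => [[le_sz /forallP le_row] i|le_row]; last first.
  split; last by apply/forallP => i; apply: le_row.
  rewrite leqNgt -row_len_gt0 -leqNgt (leq_trans (le_row _)) //.
  by rewrite leqNgt row_len_gt0 ltnn.
case: (ltnP i (size la)) => [lt_i|le_i]; first exact: (le_row (Ordinal lt_i)).
by rewrite row_len_default // (leq_trans le_sz).
Qed.

(** In a weakly decreasing list the zeros form a tail; removing it is invisible to [nth] with
    default 0. *)
Lemma nth_filter_gt0 (s : seq nat) (i : nat) :
  sorted geq s -> nth 0%N (filter (ltn 0) s) i = nth 0%N s i.
Proof.
have geq_trans : transitive geq by move=> x y z le_xy /leq_trans; apply.
elim: s i => //= x s IHs i x_s; have s_sorted := path_sorted x_s.
case: posnP => [x0|x_gt0]; last by case: i => //= i; apply: IHs.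
have all0 : all (pred1 0%N) s.
  apply: sub_all (order_path_min geq_trans x_s) => y.
  by rewrite /= x0 leqn0.
have /eqP -> : filter (ltn 0) s == [::].
  rewrite -size_eq0 size_filter -leqn0 leqNgt -has_count -all_predC.
  by apply: sub_all all0 => y /eqP ->.
rewrite nth_nil x0; case: i => //= i.
case: (ltnP i (size s)) => [lt_i|le_i]; last by rewrite nth_default.
by rewrite (eqP (all_nthP 0%N all0 i lt_i)).
Qed.

Lemma intpart_of_rows (r : nat) (f : nat -> nat) :
    (forall i j, (i <= j < r)%N -> (f j <= f i)%N) ->
  exists nu : intpart, forall i, row_len nu i = if (i < r)%N then f i else 0%N.
Proof.
move=> f_anti; pose s := filter (ltn 0) (mkseq f r).
have mk_sorted : sorted geq (mkseq f r).
  rewrite sorted_map; apply/(sortedP 0%N) => i; rewrite size_iota => lt_i.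
  by rewrite /= !nth_iota ?(ltnW lt_i) // f_anti // leqnSn.
have s_intpart : is_intpart s.
  rewrite /is_intpart mem_filter /= sorted_filter //.
  by move=> x y z le_xy /leq_trans; apply.
exists (IntPart s_intpart) => i; rewrite /row_len /= nth_filter_gt0 //.
by case: ltnP => [lt_i|le_i]; [rewrite nth_mkseq|rewrite nth_default ?size_mkseq].
Qed.

(** * Partitions as column choices, and their minors *)

(** Cauchy-Binet yields minors of size [size la], while the skew polynomial of a smaller [nu] has
    size [size nu]. Each added last column is zero above the diagonal (negative index) and has
    [S_0 = 1] on it, so the determinant does not change. *)
Lemma skew_schur_pad (C : fieldType) (n : nat) (la mu : intpart) (a : C) (r : nat) :
    (size mu <= size la)%N -> (size la <= r)%N ->
  skew_schur n la mu a =
  \det (\matrix_(i < r, j < r)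
    Spoly n a ((row_len la j)%:Z - (row_len mu i)%:Z + i%:Z - j%:Z)).
Proof.
move=> le_mu; elim: r => [|r IHr] le_r.
  by move: le_r; rewrite /skew_schur leqn0 => /eqP ->.
move: le_r; rewrite leq_eqVlt ltnS => /orP[/eqP <- //|le_r].
rewrite {}IHr // (expand_det_col _ ord_max) (bigD1 ord_max) //= mxE.
rewrite !row_len_default ?(leq_trans le_mu) //=.
rewrite [X in Spoly n a X](_ : _ = 0 :> int); last by lia.
rewrite [Spoly n a 0]Spoly_nat0 mul1r [X in _ + X]big1 ?addr0 => [|i neq_i]; last first.
  have lt_ir : (i < r)%N.
    by have := ltn_ord i; move: neq_i; rewrite -val_eqE /=; lia.
  rewrite mxE (row_len_default (la := la)) //=.
  by rewrite Spoly_lt0 ?mul0r //; lia.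
rewrite /cofactor addnn -mul2n exprM sqrrN expr1n expr1n mul1r.
by congr (\det _); apply/matrixP => i j; rewrite !mxE !lift_max.
Qed.

Fact shifted_row_subproof (r c : nat) (nu : intpart) (i : 'I_r) :
  (c + i - row_len nu i < c + r)%N.
Proof. by rewrite (leq_ltn_trans (leq_subr _ _)) // ltn_add2l. Qed.

(* Column [k] of the Cauchy-Binet factorization stands for the integer [c - k],
   so that a partition [nu] with at most [r] rows and parts at most [c] selects
   the columns [k_i] with [c - k_i = nu_i - i]. *)
Definition shifted_rows (r c : nat) (nu : intpart) : {ffun 'I_r -> 'I_(c + r)} :=
  [ffun i => Ordinal (shifted_row_subproof c nu i)].

Lemma shifted_rowsE (r c : nat) (nu : intpart) (i : 'I_r) :
  (row_len nu 0 <= c)%N ->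
  c%:Z - (shifted_rows r c nu i)%:Z = (row_len nu i)%:Z - i%:Z.
Proof.
move=> le_c; have := leq_trans (row_len_anti nu (leq0n i)) le_c.
by rewrite ffunE /=; lia.
Qed.

Lemma shifted_rows_increasing (r c : nat) (nu : intpart) :
  (row_len nu 0 <= c)%N -> increasing (shifted_rows r c nu).
Proof.
move=> le_c; apply/increasingP => i j lt_ij.
have := row_len_anti nu (ltnW lt_ij).
by have := shifted_rowsE i le_c; have := shifted_rowsE j le_c; lia.
Qed.

(** Solving [c - f i = nu_i - i] gives [nu_i = c + i - f i]. Strict increase of [f] makes these rows
    weakly decreasing, and the bounds say that [nu] lies between [mu] and [la]. *)
Lemma mem_shifted_rows (la mu : intpart)
    (f : {ffun 'I_(size la) -> 'I_(row_len la 0 + size la)}) :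
    (mu <= la)%P -> increasing f ->
    (forall i : 'I_(size la), (row_len mu i)%:Z - i%:Z <= (row_len la 0)%:Z - (f i)%:Z
       <= (row_len la i)%:Z - i%:Z) ->
  f \in [seq shifted_rows (size la) (row_len la 0) nu | nu <- intpart_interval mu la].
Proof.
move=> /le_intpartP le_mula f_incr f_bounds; set r := size la in f f_incr f_bounds *.
set c := row_len la 0 in f f_incr f_bounds *.
pose row k := if insub k is Some i then (c + k - f i)%N else 0%N.
have rowE (i : 'I_r) : row i = (c + i - f i)%N by rewrite /row valK.
(* Each step raises [f] by at least 1, which offsets the growth of [i] in [c + i - f i]. *)
have f_step (i j : 'I_r) : (i <= j)%N -> (f i + (j - i) <= f j)%N.
  move: i j; suff step d (i j : 'I_r) : (j = i + d :> nat)%N -> (f i + d <= f j)%N.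
    by move=> i j le_ij; apply: step; rewrite subnKC.
  elim: d i j => [|d IHd] i j eq_j.
    by rewrite addn0 (_ : i = j) //; apply/val_inj; rewrite /= eq_j addn0.
  have lt_k : (i + d < r)%N by have := ltn_ord j; lia.
  have := IHd i (Ordinal lt_k) erefl.
  have /(_ (Ordinal lt_k) j) := increasingP _ f_incr.
  by rewrite /= eq_j => /(_ ltac:(lia)); lia.
have [i j /andP[le_ij lt_jr]|nu nu_row] := @intpart_of_rows r row.
  have := f_step (Ordinal (leq_ltn_trans le_ij lt_jr)) (Ordinal lt_jr) le_ij.
  rewrite (rowE (Ordinal lt_jr)) (rowE (Ordinal (leq_ltn_trans le_ij lt_jr))) /=.
  by lia.
have nuE (i : 'I_r) : (row_len nu i)%:Z = c%:Z + i%:Z - (f i)%:Z.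
  rewrite nu_row ltn_ord rowE; have /andP[] := f_bounds i.
  by lia.
have le_c : (row_len nu 0 <= c)%N.
  have [r0|r_gt0] := posnP r; first by rewrite nu_row r0.
  have := nuE (Ordinal r_gt0); have /andP[] := f_bounds (Ordinal r_gt0).
  by rewrite /= -/c; lia.
apply/mapP; exists nu; last first.
  apply/ffunP => i; apply/val_inj => /=.
  by have := shifted_rowsE i le_c; rewrite nuE; lia.
rewrite mem_intpart_interval; apply/andP; split; apply/le_intpartP => i.
  have [lt_i|le_i] := ltnP i r; last first.
    by rewrite (leq_trans (le_mula i)) // row_len_default.
  have /andP[] := f_bounds (Ordinal lt_i); have := nuE (Ordinal lt_i).
  by rewrite /=; lia.
have [lt_i|le_i] := ltnP i r; last by rewrite nu_row ltnNge le_i.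
have /andP[] := f_bounds (Ordinal lt_i); have := nuE (Ordinal lt_i).
by rewrite /=; lia.
Qed.

(** * The addition formula for skew Schur polynomials *)

Lemma skew_schur_add (C : numFieldType) (n : nat) (a b : C) (la mu : intpart) :
    (mu <= la)%P ->
  skew_schur n la mu (a + b) =
  \sum_(nu <- intpart_interval mu la) skew_schur n la nu a * skew_schur n nu mu b.
Proof.
move=> le_mula; pose c := row_len la 0.
(* The inner index [k] stands for [c - k], which runs from [c], the largest possible [la_j - j],
   down to [1 - size la], the least possible [mu_i - i]. *)
pose B : 'M_(size la, c + size la) :=
  \matrix_(i, k) Spoly n b (c%:Z - k%:Z - ((row_len mu i)%:Z - i%:Z)).
pose A : 'M_(c + size la, size la) :=
  \matrix_(k, j) Spoly n a ((row_len la j)%:Z - j%:Z - (c%:Z - k%:Z)).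
have -> : skew_schur n la mu (a + b) = \det (B *m A).
  rewrite /skew_schur; congr (\det _); apply/matrixP => i j; rewrite !mxE.
  transitivity (Spoly n (a + b)
    ((row_len la j)%:Z - j%:Z - ((row_len mu i)%:Z - i%:Z))).
    by congr Spoly; lia.
  rewrite (Spoly_add n a b (c := c%:Z) (N := c + size la)).
  - by apply: eq_bigr => k _; rewrite !mxE.
  - by have := row_len_anti la (leq0n j); rewrite -/c; lia.
  by have := ltn_ord i; lia.
have le_c nu : nu \in intpart_interval mu la -> (row_len nu 0 <= c)%N.
  by rewrite mem_intpart_interval => /andP[_ /le_intpartP].
have le_size nu nu' : (nu <= nu')%P -> (size nu <= size nu')%N by case/andP.
rewrite cauchy_binet.
pose s := [seq shifted_rows (size la) c nu | nu <- intpart_interval mu la].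
transitivity (\sum_(f <- s)
    \det (colsub f B) * \det (rowsub f A)).
  (* Distinct partitions of the interval select distinct columns, so the list sum is a sum over a
     set of maps. *)
  rewrite big_uniq /=; last first.
    rewrite map_inj_in_uniq ?intpart_interval_uniq // => nu nu' nu_in nu'_in eq_rows.
    apply: row_len_inj => i; have [lt_i|le_i] := ltnP i (size la).
      have := shifted_rowsE (Ordinal lt_i) (le_c _ nu_in).
      by have := shifted_rowsE (Ordinal lt_i) (le_c _ nu'_in); rewrite eq_rows /=; lia.
    move: nu_in nu'_in; rewrite !mem_intpart_interval => /andP[_ nu_la] /andP[_ nu'_la].
    by rewrite !row_len_default // (leq_trans (le_size _ _ _) le_i).
  rewrite (bigID (mem s)) /=.
  rewrite [X in _ + X]big1 ?addr0 => [|f /andP[f_incr]]; last first.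
    have f_mono (i j : 'I_(size la)) : (i <= j)%N -> (f i <= f j)%N.
      rewrite leq_eqVlt => /orP[/eqP/val_inj -> //|lt_ij].
      exact/ltnW/(increasingP _ f_incr).
    apply: contraNeq => det_neq0; apply: mem_shifted_rows => //; rewrite -/c => i.
    (* If row [i] violates a bound, monotonicity makes all indices negative in rows up to [i] and
       columns from [i] on: in the minor of [B] when the lower bound fails, in that of [A] when the
       upper one does. *)
    apply: contra_neqT det_neq0; rewrite negb_and -!ltNge => /orP[] lt_i.
      rewrite (det_zero_block (k := i)) ?mul0r // => i' j' /andP[le_i' le_j'].
      rewrite !mxE Spoly_lt0 //.
      by have := f_mono _ _ le_j'; have := row_len_anti mu le_i'; lia.
    rewrite [X in _ * X](det_zero_block (k := i)) ?mulr0 // => i' j' /andP[le_i' le_j'].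
    rewrite !mxE Spoly_lt0 //.
    by have := f_mono _ _ le_i'; have := row_len_anti la le_j'; lia.
  apply: eq_bigl => f; case: mapP; rewrite ?andbF // => -[nu nu_in ->].
  by rewrite andbT shifted_rows_increasing // le_c.
rewrite big_map big_seq [RHS]big_seq; apply: eq_bigr => nu nu_in.
have [le_munu le_nula] : (mu <= nu)%P /\ (nu <= la)%P.
  by apply/andP; rewrite -mem_intpart_interval.
have -> : skew_schur n la nu a = \det (rowsub (shifted_rows (size la) c nu) A).
  congr (\det _); apply/matrixP => i j; rewrite !mxE.
  by rewrite shifted_rowsE ?le_c //; congr Spoly; lia.
have -> : skew_schur n nu mu b = \det (colsub (shifted_rows (size la) c nu) B).
  rewrite (skew_schur_pad n b (le_size _ _ le_munu) (le_size _ _ le_nula)).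
  congr (\det _); apply/matrixP => i j; rewrite !mxE.
  by rewrite shifted_rowsE ?le_c //; congr Spoly; lia.
exact: mulrC.
Qed.

Theorem theorem3 (R : realType) (n : nat) (hn : (1 <= n)%N) (a b : R[i])
    (la mu : intpart) (hmula : (mu <= la)%P) :
  skew_schur n la mu (a + b) =
  \sum_(nu <- intpart_interval mu la) skew_schur n la nu a * skew_schur n nu mu b.
Proof. exact: skew_schur_add. Qed.
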